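(* A finitely generated torsion-free ring has polynomial growth if and only if it is virtually nilpotent.
   Context: Rings are associative but not necessarily commutative or unital. Torsion-free means that the additive group is torsion-free. For a subset $X$ of a ring, $X^{\leq n}$ denotes the set of elements obtained from $X$ using $+$ and $\cdot$ in such a way that elements of $X$ are used at most $n$ times (counting repetitions). A ring $R$ generated by a finite additively symmetric set $X$ ($0\in X$, $X=-X$) has polynomial growth if there are $d\in\mathbb{N}$ and a constant $C$ such that $|X^{\leq n}|\leq Cn^d$ for all positive integers $n$; this does not depend on the choice of the finite generating set. A ring is nilpotent if for some $n$ every product of $n+1$ of its elements is $0$. A ring is virtually nilpotent if it has a two-sided ideal of finite (additive) index which is nilpotent (equivalently, a nilpotent subring of finite index). *)

(* Defs.v *)
From HB Require Import structures.
From mathcomp Require Import all_boot all_algebra.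
From mathcomp Require Import boolp classical_sets functions cardinality.

Set Implicit Arguments.
Unset Strict Implicit.
Unset Printing Implicit Defensive.

Import GRing.Theory.
Local Open Scope classical_set_scope.
Local Open Scope card_scope.
Local Open Scope ring_scope.

(* The rings of ssralg all have a unit (possibly equal to 0); [rngType] is the
   interface of associative rings with no unit and no commutativity required. *)
HB.mixin Record Zmodule_isRng R of GRing.Zmodule R := {
  rng_mul : R -> R -> R;
  rng_mulA : associative rng_mul;
  rng_mulDl : left_distributive rng_mul +%R;
  rng_mulDr : right_distributive rng_mul +%R
}.

#[short(type="rngType")]
HB.structure Definition Rng := { R of GRing.Zmodule R & Zmodule_isRng R }.

Notation "x ** y" := (rng_mul x y) (at level 40, left associativity) : ring_scope.

Definition torsion_free (V : zmodType) : Prop :=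
  forall (x : V) (n : nat), (0 < n)%N -> x *+ n = 0 -> x = 0.

Section Rngs.
Variable R : rngType.
Implicit Types (X S I : set R) (a b x y : R) (d m n C : nat).

Definition additive_subgroup S : Prop :=
  S 0 /\ forall x y, S x -> S y -> S (x - y).

Definition subrng S : Prop :=
  additive_subgroup S /\ forall x y, S x -> S y -> S (x ** y).

Definition two_sided_ideal I : Prop :=
  additive_subgroup I /\ forall a x, I x -> I (a ** x) /\ I (x ** a).

Definition generates X : Prop :=
  forall S, subrng S -> X `<=` S -> S = [set: R].

Definition finitely_generated : Prop :=
  exists X, finite_set X /\ generates X.

(* [uses X m a]: a is the value of an expression built from elements of X with
   + and **, having exactly m leaves (counted with repetitions). *)
Inductive uses X : nat -> R -> Prop :=
| uses_gen a : X a -> uses X 1 a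
| uses_add m n a b : uses X m a -> uses X n b -> uses X (m + n) (a + b)
| uses_mul m n a b : uses X m a -> uses X n b -> uses X (m + n) (a ** b).

(* The set X^{<= n}. *)
Definition at_most X n : set R := [set a | exists2 m, (m <= n)%N & uses X m a].

Definition additively_symmetric X : Prop :=
  X 0 /\ forall x, X x -> X (- x).

(* |X^{<= n}| <= C n^d for n >= 1. Since C may be rounded up, it is taken in nat. *)
Definition polynomially_bounded X : Prop :=
  exists d C, forall n, (0 < n)%N -> at_most X n #<= `I_(C * n ^ d).

(* The choice of X is immaterial: see [polynomial_growth_any] below. *)
Definition polynomial_growth : Prop :=
  exists X, [/\ finite_set X, additively_symmetric X, generates X
              & polynomially_bounded X].

(* The products of n + 1 elements of I all vanish, for some n >= 0. *)
Definition nilpotent_subset I : Prop :=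
  exists n, forall a (s : n.-tuple R),
    I a -> (forall x, x \in s -> I x) -> foldl rng_mul a s = 0.

(* Finitely many cosets. *)
Definition finite_index I : Prop :=
  finite_set (range (fun a => [set a + x | x in I])).

Definition virtually_nilpotent : Prop :=
  exists I, [/\ two_sided_ideal I, finite_index I & nilpotent_subset I].

Lemma at_most_le X m n : (m <= n)%N -> at_most X m `<=` at_most X n.
Proof. by move=> mn a [k km ka]; exists k => //; apply: leq_trans mn. Qed.

Lemma rng_mulNr a b : a ** (- b) = - (a ** b).
Proof.
have a0 : a ** 0 = 0 by apply: (addrI (a ** 0)); rewrite -rng_mulDr !addr0.
by apply/eqP; rewrite -addr_eq0 -rng_mulDr addNr a0.
Qed.

Lemma usesN X m a : additively_symmetric X -> uses X m a -> uses X m (- a).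
Proof.
move=> [_ XN]; elim=> {m a} [a /XN|m n a b _ IHa _ IHb|m n a b ua _ _ IHb].
- exact: uses_gen.
- by rewrite opprD; apply: uses_add.
- by rewrite -rng_mulNr; apply: uses_mul.
Qed.

Lemma generates_at_most X a :
  additively_symmetric X -> generates X -> exists n, at_most X n a.
Proof.
move=> Xsym /(_ [set a | exists m, uses X m a]) genX.
have {genX} : [set a | exists m, uses X m a] = [set: R].
  apply: genX; last by move=> x Xx; exists 1; apply: uses_gen.
  split; last by move=> x y [m mx] [n ny]; exists (m + n)%N; apply: uses_mul.
  split; first by exists 1; apply: uses_gen; case: Xsym.
  move=> x y [m mx] [n ny]; exists (m + n)%N; apply: uses_add => //.
  exact: usesN.
by move/seteqP => [_ /(_ a I)] [m ma]; exists m, m.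
Qed.

Lemma generates_at_most_finite X Y :
  additively_symmetric X -> generates X -> finite_set Y ->
  exists n, Y `<=` at_most X n.
Proof.
move=> Xsym genX /finite_seqP[s ->]; elim: s => [|y s [n IHs]].
  by exists 0%N => x.
have [k ky] := generates_at_most y Xsym genX.
exists (maxn k n) => x /=; rewrite inE => /orP[/eqP->|xs].
  exact: at_most_le (leq_maxl _ _) _ ky.
exact: at_most_le (leq_maxr _ _) _ (IHs _ xs).
Qed.

Lemma uses_comp X Y k m a :
  Y `<=` at_most X k -> uses Y m a -> at_most X (k * m) a.
Proof.
move=> YX; elim=> {m a} [a /YX|m n a b _ [i im ia] _ [j jn jb]|
    m n a b _ [i im ia] _ [j jn jb]]; first by rewrite muln1.
- by exists (i + j)%N; [rewrite mulnDr leq_add|apply: uses_add].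
- by exists (i + j)%N; [rewrite mulnDr leq_add|apply: uses_mul].
Qed.

Lemma polynomial_growth_any Y :
  finite_set Y -> additively_symmetric Y -> generates Y ->
  polynomial_growth <-> polynomially_bounded Y.
Proof.
move=> Yfin Ysym genY; split; last by exists Y.
case=> X [_ Xsym genX [d [C XC]]].
have [k YX] := generates_at_most_finite Xsym genX Yfin.
exists d, (C * k.+1 ^ d)%N => n n0.
have YXn : at_most Y n `<=` at_most X (k.+1 * n).
  move=> a [m mn ua]; apply: at_most_le (uses_comp YX ua).
  by rewrite leq_mul.
apply: card_le_trans (subset_card_le YXn) _.
by rewrite -mulnA -expnMn; apply: XC; rewrite muln_gt0.
Qed.

End Rngs.

Arguments finitely_generated R : clear implicits.
Arguments polynomial_growth R : clear implicits.
Arguments virtually_nilpotent R : clear implicits.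

(* Main.v *)
(* If I is an ideal of finite index, every x has a positive multiple in I, so in
   the torsion-free case I nilpotent forces R nilpotent; conversely R is an ideal
   of index 1 in itself. It remains to see that polynomial growth amounts to
   nilpotency.

   Growth implies nilpotency. If v b = v with v != 0, then 2b acts on v on the
   right as multiplication by 2, and Horner's scheme at 2b gives, for each
   N < 2^n, an element y of length O(n) with v y = N v: exponential growth.
   Hence v b = v implies v = 0. Now let x_0 x_1 ... x_n be a nonzero product of
   generators, with prefixes v_0, v_1, ... Two subset sums of the v_i that first
   differ at i would give v_i = v_i r, so v_i = 0; the 2^n subset sums are thus
   distinct, and they have length O(n^2), which bounds n.

   Nilpotency implies growth. If the products of more than n factors vanish, an
   expression with M leaves is a sum of at most M^n words of length at most n,
   and there are finitely many such words. *)

Require Import Defs.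
From mathcomp Require Import all_boot all_algebra.
From mathcomp Require Import boolp classical_sets functions cardinality.

Set Implicit Arguments.
Unset Strict Implicit.
Unset Printing Implicit Defensive.

Import GRing.Theory.
Local Open Scope classical_set_scope.
Local Open Scope card_scope.
Local Open Scope ring_scope.

(** * Counting: pigeonhole, and exponentials against polynomials *)

Lemma pigeonhole_fin (T : finType) (U : Type) (A : set U) (f : T -> U) B :
  A #<= `I_B -> (forall t, A (f t)) -> (B < #|T|)%N ->
  exists t u, t != u /\ f t = f u.
Proof.
move=> /pcard_leP[g] fA ltB; apply: contrapT => Nf.
have gB t : (g (f t) < B)%N by have := @funS _ _ _ _ g _ (fA t).
have injf : injective (fun t => Ordinal (gB t)).
  move=> t u [gtu]; apply: contrapT => /eqP tu; apply: Nf; exists t, u.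
  by split=> //; apply: (@inj _ _ _ g) gtu; rewrite inE.
by have := leq_card _ injf; rewrite card_ord leqNgt ltB.
Qed.

Lemma card_range_fin (T : finType) (U : Type) (f : T -> U) :
  range f #<= `I_#|T|.
Proof.
have -> : range f = (f \o enum_val) @` [set: 'I_#|T|].
  apply/seteqP; split=> [_ [t _ <-]|_ [i _ <-]]; last by exists (enum_val i).
  by exists (enum_rank t) => //=; rewrite enum_rankK.
by rewrite (card_le_eqr card_II); exact: card_image_le.
Qed.

Lemma exp2_dominates A d : exists2 n, (0 < n)%N & (A * n ^ d < 2 ^ n)%N.
Proof.
(* For n = m e one has A n^d = A e^d m^d < m^{d+1} <= (2^m)^e = 2^n. *)
pose e := d.+1; pose m := (A * e ^ d).+1.
exists (m * e)%N => //; rewrite expnM.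
apply: (@leq_trans (m ^ e)); last by rewrite leq_exp2r// ltnW// ltn_expl.
by rewrite expnMn mulnCA /e expnSr ltn_pmul2l ?expn_gt0// /m ltnS.
Qed.

Section RngTheory.
Variable R : rngType.
Implicit Types (X I : set R) (a b v x y : R).

(** * Arithmetic without a unit *)

Lemma rng_mulr0 a : a ** 0 = 0.
Proof. by apply: (addrI (a ** 0)); rewrite -rng_mulDr !addr0. Qed.

Lemma rng_mul0r a : 0 ** a = 0.
Proof. by apply: (addrI (0 ** a)); rewrite -rng_mulDl !addr0. Qed.

Lemma rng_mulBr a b c : a ** (b - c) = a ** b - a ** c.
Proof. by rewrite rng_mulDr rng_mulNr. Qed.

Lemma rng_mulrnAl a b n : (a *+ n) ** b = (a ** b) *+ n.
Proof. by elim: n => [|n IHn]; rewrite ?rng_mul0r// !mulrS rng_mulDl IHn. Qed.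

Lemma rng_mulrnAr a b n : a ** (b *+ n) = (a ** b) *+ n.
Proof. by elim: n => [|n IHn]; rewrite ?rng_mulr0// !mulrS rng_mulDr IHn. Qed.

Lemma foldl_rng0 (s : seq R) : foldl rng_mul 0 s = 0.
Proof. by elim: s => //= x s; rewrite rng_mul0r. Qed.

Lemma foldl_rngD a b (s : seq R) :
  foldl rng_mul (a + b) s = foldl rng_mul a s + foldl rng_mul b s.
Proof. by elim: s a b => //= x s IHs a b; rewrite rng_mulDl IHs. Qed.

Lemma foldl_rngMn a (s : seq R) n :
  foldl rng_mul (a *+ n) s = foldl rng_mul a s *+ n.
Proof. by elim: s a => //= x s IHs a; rewrite rng_mulrnAl IHs. Qed.

Lemma foldl_rngM a b (s : seq R) :
  foldl rng_mul (a ** b) s = a ** foldl rng_mul b s.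
Proof. by elim: s b => //= x s IHs b; rewrite -rng_mulA IHs. Qed.

(** * Annihilation by products; virtual nilpotency in the torsion-free case *)

Definition kills X n v : Prop :=
  forall s : seq R, size s = n -> (forall x, x \in s -> X x) ->
    foldl rng_mul v s = 0.

Lemma nilpotent_subsetP I :
  nilpotent_subset I <-> exists n, forall a, I a -> kills I n a.
Proof.
split=> -[n nilI]; exists n => a; first move=> Ia s /eqP sn Is.
  exact: (nilI a (Tuple sn)).
by move=> s Ia Is; apply: nilI => //; rewrite size_tuple.
Qed.

Lemma kills_tail X n v x : X x -> kills X n.+1 v -> kills X n (v ** x).
Proof.
move=> Xx kv s sn Xs; apply: (kv (x :: s)); rewrite /= ?sn// => y.
by rewrite inE => /orP[/eqP->|/Xs].
Qed.

Lemma kills_le X m n v : (m <= n)%N -> kills X m v -> kills X n v.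
Proof.
move=> mn kv s sn Xs; rewrite -(cat_take_drop m s) foldl_cat kv ?foldl_rng0//.
  by rewrite size_takel// sn.
by move=> x /mem_take/Xs.
Qed.

Lemma kills0 X v : kills X 0 v -> v = 0.
Proof. by move=> /(_ [::]); apply. Qed.

Lemma killsD X n u v : kills X n u -> kills X n v -> kills X n (u + v).
Proof. by move=> ku kv s sn Xs; rewrite foldl_rngD ku// kv// addr0. Qed.

Definition nilpotent : Prop := exists n, forall a, kills [set: R] n a.

Lemma nilpotent_virtually : nilpotent -> virtually_nilpotent R.
Proof.
move=> nilR; exists setT; split; last first.
- by apply/nilpotent_subsetP; case: nilR => n nilR; exists n.
- apply: (@sub_finite_set _ _ [set [set: R]]) => [_ [a _ <-]|]; last first.
    exact: finite_set1.
  rewrite /=; apply/seteqP; split=> // x _.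
  by exists (x - a) => //; rewrite addrC subrK.
- by [].
Qed.

(** Among more multiples of [x] than there are cosets, two lie in the same coset; their difference
    is in [I]. *)
Lemma finite_index_multiple I x :
  additive_subgroup I -> finite_index I -> exists2 m, (0 < m)%N & I (x *+ m).
Proof.
move=> [I0 IB] /finite_setP[B /card_eqPle[leB _]].
have [||i [j [ij eqij]]] := pigeonhole_fin
  (f := fun i : 'I_B.+1 => [set x *+ i + y | y in I]) leB.
- by move=> i; exists (x *+ i).
- by rewrite card_ord.
wlog lt_ij : i j ij eqij / (i < j)%N.
  move=> wlt; case: (ltngtP i j) => [|ji|/val_inj/eqP]; last by rewrite (negPf ij).
  - exact: wlt eqij.
  - by apply: (wlt j i) => //; rewrite eq_sym.
exists (j - i)%N; first by rewrite subn_gt0.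
have [y Iy /eqP] : [set x *+ i + y | y in I] (x *+ j).
  by rewrite eqij; exists 0; rewrite ?addr0.
by rewrite eq_sym addrC -subr_eq -mulrnBr ?(ltnW lt_ij)// => /eqP->.
Qed.

(** Each factor is replaced by a positive multiple in [I]; the integers come out of the product and
    cancel. *)
Lemma kills_torsion_free I n v :
  torsion_free R -> (forall x, exists2 m, (0 < m)%N & I (x *+ m)) ->
  kills I n v -> kills [set: R] n v.
Proof.
move=> tfR Imul; elim: n v => [|n IHn] v kv [|x s]//= => [_ _|[sn] _].
  exact: kills0 kv.
have [m m0 Ixm] := Imul x.
have /IHn /(_ s sn (fun _ _ => Logic.I)) := kills_tail Ixm kv.
by rewrite rng_mulrnAr foldl_rngMn => /tfR; apply.
Qed.

Lemma virtually_nilpotent_nilpotent :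
  torsion_free R -> virtually_nilpotent R -> nilpotent.
Proof.
move=> tfR [I [[Isub _] Ifin /nilpotent_subsetP[n nilI]]]; exists n => a.
have Imul x := finite_index_multiple x Isub Ifin.
have [m m0 /nilI /(kills_torsion_free tfR Imul) ka] := Imul a.
by move=> s /ka ks /ks; rewrite foldl_rngMn => /tfR; apply.
Qed.

(** * Lengths of expressions *)

Lemma at_mostD X m n a b :
  at_most X m a -> at_most X n b -> at_most X (m + n) (a + b).
Proof.
move=> [i im ua] [j jn ub]; exists (i + j)%N; first exact: leq_add.
exact: uses_add.
Qed.

Lemma at_mostM X m n a b :
  at_most X m a -> at_most X n b -> at_most X (m + n) (a ** b).
Proof.
move=> [i im ua] [j jn ub]; exists (i + j)%N; first exact: leq_add.
exact: uses_mul.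
Qed.

Lemma at_most_gt0 X n a : at_most X n a -> (0 < n)%N.
Proof.
move=> [m mn ua]; apply: leq_trans mn.
by elim: ua => // i j *; rewrite addn_gt0; apply/orP; left.
Qed.

Lemma at_most_gen X n a : X a -> (0 < n)%N -> at_most X n a.
Proof. by move=> Xa n0; exists 1%N => //; apply: uses_gen. Qed.

(** * Polynomial growth implies nilpotency *)

Section PolynomialGrowth.
Variable X : set R.
Hypotheses (tfR : torsion_free R) (Xsym : additively_symmetric X).
Hypotheses (genX : generates X) (Xpoly : polynomially_bounded X).

Let X0 : X 0. Proof. by case: Xsym. Qed.

(* Horner's scheme at 2b, which acts on v as multiplication by 2. *)
Lemma horner_at_most k b v n N :
  at_most X k b -> v ** b = v -> (N < 2 ^ n)%N ->
  exists y, at_most X (1 + 3 * k * n) y /\ v ** y = v *+ N.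
Proof.
move=> kb vb; elim: n N => [|n IHn] N ltN.
  move: ltN; rewrite expn0 ltnS leqn0 => /eqP->; exists 0.
  by split; [exact: at_most_gen|rewrite rng_mulr0].
have [|y [ny vy]] := IHn N./2.
  by rewrite ltn_half_double -mul2n -expnS.
exists (y ** (b + b) + (if odd N then b else 0)); split.
  have kc : at_most X k (if odd N then b else 0).
    by case: odd => //; apply: at_most_gen; last exact: at_most_gt0 kb.
  have := at_mostD (at_mostM ny (at_mostD kb kb)) kc; congr at_most.
  by rewrite mulnS -!addnA; congr addn; rewrite addnC !mulSn mul0n addn0 !addnA.
rewrite rng_mulDr rng_mulA vy rng_mulrnAl rng_mulDr vb.
rewrite -[in RHS](odd_double_half N) addnC mulrnDr -mul2n mulrnA mulr2n.
by congr (_ + _); case: odd; rewrite ?rng_mulr0.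
Qed.

Lemma no_fixed_vector v b : v ** b = v -> v = 0.
Proof.
move=> vb; have [k kb] := generates_at_most b Xsym genX.
have [d [C XC]] := Xpoly.
(* For n >= 1, K n bounds the length 1 + 3 k n; as C (K n)^d < 2^n, two numbers N < 2^n must share
   the same y. *)
pose K := (1 + 3 * k)%N.
have [n n0 ltn2] := exp2_dominates (C * K ^ d) d.
have /choice[f fP] (i : 'I_(2 ^ n)) :
    exists y, at_most X (K * n) y /\ v ** y = v *+ i.
  have [y [ny vy]] := horner_at_most kb vb (ltn_ord i).
  exists y; split=> //; apply: at_most_le ny.
  by rewrite /K [((1 + _) * n)%N]mulnDl mul1n leq_add2r.
have [|||i [j [ij fij]]] := pigeonhole_fin (XC (K * n)%N _) (f := f).
- by rewrite muln_gt0.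
- by move=> i; case: (fP i).
- by rewrite card_ord expnMn mulnA.
wlog lt_ij : i j ij fij / (i < j)%N.
  move=> wlt; case: (ltngtP i j) => [|ji|/val_inj/eqP]; last by rewrite (negPf ij).
  - exact: wlt fij.
  - by apply: (wlt j i) => //; rewrite eq_sym.
apply: (tfR (n := (j - i)%N)); first by rewrite subn_gt0.
rewrite mulrnBr ?(ltnW lt_ij)//.
by case: (fP i) (fP j) => _ <- [_ <-]; rewrite fij subrr.
Qed.

(** The bits select among the proper prefixes v, v x_0, v x_0 x_1, ...; the full product is never a
    summand. *)
Fixpoint subset_sum v (e : bitseq) (s : seq R) : R :=
  match e, s with
  | c :: e', x :: s' => (if c then v else 0) + subset_sum (v ** x) e' s'
  | _, _ => 0
  end.

(** The factor [r] absorbs [x]: without a unit, [v ** x] itself need not be a right multiple of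
    [v ** x]. *)
Lemma subset_sum_mul v x e s : exists r, subset_sum (v ** x) e s = v ** r.
Proof.
elim: e s x => [|c e IHe] [|y s] x /=; try by exists 0; rewrite rng_mulr0.
rewrite -rng_mulA; have [r ->] := IHe s (x ** y).
exists ((if c then x else 0) + r); rewrite rng_mulDr.
by case: c; rewrite ?rng_mulr0.
Qed.

(* At the first place where two subsets differ, the prefix v at that place
   satisfies v = v ** r. *)
Lemma subset_sum_collision v e e' s :
  size e = size s -> size e' = size s -> e != e' ->
  subset_sum v e s = subset_sum v e' s -> foldl rng_mul v s = 0.
Proof.
elim: s v e e' => [|x s IHs] v [|c e] [|c' e']//= [se] [se'] nee' eqS.
have [cc'|ncc'] := eqVneq c c'.
  move: nee' eqS; rewrite -{}cc' eqseq_cons eqxx /= => nee' /addrI.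
  exact: IHs.
suff -> : v = 0 by rewrite rng_mul0r foldl_rng0.
have [r er] := subset_sum_mul v x e s; have [r' er'] := subset_sum_mul v x e' s.
move: eqS ncc'; rewrite er er'; case: c c' {nee'} => -[]//=; rewrite add0r => eqS _.
- by apply: (@no_fixed_vector _ (r' - r)); rewrite rng_mulBr -eqS addrK.
- by apply: (@no_fixed_vector _ (r - r')); rewrite rng_mulBr eqS addrK.
Qed.

(** There are [size s] prefixes, each of length at most [m + size s]; the extra 1 pays for the final
    0, a generator. *)
Lemma subset_sum_at_most m v e s :
  (0 < m)%N -> at_most X m v -> (forall x, x \in s -> X x) ->
  at_most X ((m + size s) * size s + 1) (subset_sum v e s).
Proof.
elim: s m v e => [|x s IHs] m v [|c e] m0 mv Xs /=;
  try by apply: at_most_gen; rewrite // addn1.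
have Xx : X x by apply: Xs; rewrite inE eqxx.
have mc : at_most X m (if c then v else 0).
  by case: c => //; apply: at_most_gen.
have := at_mostD mc (IHs _ (v ** x) e _ (at_mostM mv (at_most_gen Xx (ltn0Sn 0))) _).
rewrite addn_gt0 m0 => /(_ isT) H.
apply: at_most_le (H _) => [|y ys]; last by apply: Xs; rewrite inE ys orbT.
by rewrite addnA leq_add2r mulnS -addnA addSnnS leq_add2r leq_addr.
Qed.

Lemma generators_killed : exists n, forall x, X x -> kills X n x.
Proof.
have [d [C XC]] := Xpoly.
(* The subset sums have length at most (1 + n) n + 1 <= 3 n^2, whence the factor 3^d and the
   exponent 2d. *)
have [n n0 ltn2] := exp2_dominates (C * 3 ^ d) d.*2.
exists n => x Xx s sn Xs.
have n3 : (0 < 3 * n ^ 2)%N by rewrite muln_gt0 expn_gt0 n0.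
have [||e [e' [ee' eqS]]] := pigeonhole_fin (T := n.-tuple bool) (XC _ n3)
  (f := fun e => subset_sum x e s).
- move=> e; apply: at_most_le (subset_sum_at_most e _ (at_most_gen (n := 1) Xx _) Xs) => //.
  rewrite sn add1n -mulnn !mulSn mul0n addn0 -addnA.
  by rewrite !leq_add ?leq_pmulr ?muln_gt0 ?n0.
- by rewrite card_tuple card_bool expnMn -expnM mul2n mulnA.
by apply: subset_sum_collision eqS; rewrite ?size_tuple.
Qed.

Lemma growth_nilpotent : nilpotent.
Proof.
have [n Xn] := generators_killed.
(* Multiplying by any [b] does the work of at least one generator, since [b] expands into nonempty
   products of generators. *)
have killsM m b : uses X m b ->
    forall i a, kills X i.+1 a -> kills X i (a ** b).
  elim=> {m b} [b Xb|m m' b c _ IHb _ IHc|m m' b c _ IHb _ IHc] i a ka.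
  - exact: kills_tail.
  - by rewrite rng_mulDr; apply: killsD; [exact: IHb|exact: IHc].
  - by rewrite rng_mulA; apply: IHc; apply: kills_le (IHb _ _ ka).
(* Any [a] is a sum of products starting with a generator, so [n] serves for all of [R]. *)
have killsR a : kills X n a.
  have [_ [m _]] := generates_at_most a Xsym genX.
  elim=> {m a} [a /Xn//|m m' a b _ ka _ kb|m m' a b _ ka ub _].
  - exact: killsD.
  - exact/(killsM _ _ ub)/(kills_le (leqnSn n)).
exists n => a s sn _.
(* Arbitrary factors are now absorbed one by one through [killsM]. *)
move: (killsR a) => {Xn killsR}; elim: s n a sn => [|x s IHs] [|n] a //= => [_|[sn] ka].
  exact: kills0.
have [_ [m _ /killsM/(_ _ _ ka)]] := generates_at_most x Xsym genX.
exact: IHs.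
Qed.

End PolynomialGrowth.

(** * Nilpotency implies polynomial growth *)

Section NilpotentGrowth.
Variable X : set R.

Inductive word : nat -> R -> Prop :=
| word_gen x : X x -> word 1 x
| word_mul d e x y : word d x -> word e y -> word (d + e) (x ** y).

Lemma word_foldl d x :
  word d x -> exists a s, d = (size s).+1 /\ x = foldl rng_mul a s.
Proof.
elim=> {d x} [x _|d e x y _ [a [s [-> ->]]] _ [b [t [-> ->]]]].
  by exists x, [::].
exists a, (s ++ b :: t); split; first by rewrite size_cat.
by rewrite foldl_cat /= foldl_rngM.
Qed.

Lemma word_eq0 n d x :
  (forall a, kills [set: R] n a) -> word d x -> (n < d)%N -> x = 0.
Proof.
move=> nilR /word_foldl[a [s [-> ->]]]; rewrite ltnS => ns.
exact: (kills_le ns (nilR a)).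
Qed.

Lemma word_gt0 d x : word d x -> (0 < d)%N.
Proof. by elim=> // i j *; rewrite addn_gt0; apply/orP; left. Qed.

Lemma finite_words n : finite_set X ->
  exists W : seq R, forall d x, word d x -> (d <= n)%N -> x \in W.
Proof.
move=> /finite_seqP[s Xs]; elim: n => [|n [W IHW]].
  by exists [::] => d x /word_gt0; case: d.
(* A word that is not a single generator splits into two nonempty, hence shorter, words. *)
exists (s ++ [seq x ** y | x <- W, y <- W]) => _ _ [x|d e x y wx wy].
  by rewrite Xs mem_cat => ->.
move=> den; rewrite mem_cat; apply/orP; right.
have d0 := word_gt0 wx; have e0 := word_gt0 wy.
apply/allpairs_f.
- by apply: IHW wx _; rewrite -ltnS; apply: leq_trans den; rewrite -addn1 leq_add2l.
- by apply: IHW wy _; rewrite -ltnS; apply: leq_trans den; rewrite -add1n leq_add2r.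
Qed.

Lemma rng_mul_suml (I : Type) (r : seq I) (F : I -> R) b :
  (\sum_(i <- r) F i) ** b = \sum_(i <- r) F i ** b.
Proof.
exact: (big_morph (fun a => a ** b) (fun x y => rng_mulDl x y b) (rng_mul0r b)).
Qed.

Lemma rng_mul_sumr (I : Type) (r : seq I) (F : I -> R) a :
  a ** (\sum_(i <- r) F i) = \sum_(i <- r) a ** F i.
Proof. exact: (big_morph (rng_mul a) (rng_mulDr a) (rng_mulr0 a)). Qed.

(* With weight M^{n - d} on words of length d, an expression with m <= M leaves
   expands to words of total weight at most m M^{n - 1}: a product of two words
   satisfies M^n w(x ** y) = w(x) w(y). *)
Lemma uses_words n M m a :
  (forall d x, word d x -> (n < d)%N -> x = 0) -> (0 < n)%N -> (0 < M)%N ->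
  uses X m a -> (m <= M)%N ->
  exists L : seq (nat * R),
    [/\ a = \sum_(p <- L) p.2,
        forall p, p \in L -> word p.1 p.2 /\ (p.1 <= n)%N
      & ((\sum_(p <- L) M ^ (n - p.1)) * M <= m * M ^ n)%N].
Proof.
move=> w0 n0 M0; elim=> {m a} [a Xa|m k a b _ IHa _ IHb|m k a b _ IHa _ IHb] leM.
- exists [:: (1%N, a)]; split.
  + by rewrite big_seq1.
  + by move=> p; rewrite inE => /eqP->; split=> //; apply: word_gen.
  + by rewrite big_seq1 -expnSr subn1 prednK// mul1n.
- have [L [-> Lw Lm]] := IHa (leq_trans (leq_addr _ _) leM).
  have [L' [-> Lw' Lm']] := IHb (leq_trans (leq_addl _ _) leM).
  exists (L ++ L'); split; rewrite ?big_cat//=.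
  + by move=> p; rewrite mem_cat => /orP[/Lw|/Lw'].
  + by rewrite !mulnDl leq_add.
have leMk := leq_trans (leq_addl _ _) leM.
have [L [-> Lw Lm]] := IHa (leq_trans (leq_addr _ _) leM).
have [L' [-> Lw' Lm']] := IHb leMk.
pose P := [seq (p.1 + q.1, p.2 ** q.2)%N | p <- L, q <- L'].
have Pw p : p \in P -> word p.1 p.2.
  by move=> /allpairsP[[u v] [/Lw[wu _] /Lw'[wv _] ->]]; apply: word_mul.
(* The discarded products have more than [n] factors and vanish by [w0]. *)
exists [seq p <- P | (p.1 <= n)%N]; split.
- rewrite big_filter [RHS]big_mkcond /=.
  rewrite [RHS](eq_big_seq (fun p : nat * R => p.2)); last first.
    by move=> p /Pw wp; case: leqP => // /(w0 _ _ wp).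
  rewrite big_allpairs_dep rng_mul_suml; apply: eq_bigr => p _.
  by rewrite rng_mul_sumr.
- by move=> p; rewrite mem_filter => /andP[pn pP]; split=> //; apply: Pw.
set S := (\sum_(p <- L) _)%N in Lm; set S' := (\sum_(p <- L') _)%N in Lm'.
set T := (\sum_(p <- _) _)%N.
have TSS : (T * M ^ n <= S * S')%N.
  rewrite /T big_filter big_mkcond /= big_allpairs_dep !big_distrl /=.
  rewrite [leqRHS]big_seq [leqLHS]big_seq; apply: leq_sum => p /Lw[_ pn].
  rewrite big_distrl big_distrr /= [leqRHS]big_seq [leqLHS]big_seq.
  apply: leq_sum => q /Lw'[_ qn]; case: ifP => [pqn|_]; last by rewrite mul0n.
  by rewrite -!expnD subnDA addnBAC ?addnBA// leq_subRL.
have Mn0 : (0 < M ^ n)%N by rewrite expn_gt0 M0.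
(* Already m M^n is a bound: after multiplication by M M^n, this follows from [TSS] and k <= M. *)
apply: (@leq_trans (m * M ^ n)%N); last by rewrite leq_mul// leq_addr.
rewrite -(leq_pmul2r M0) -(leq_pmul2r Mn0).
apply: (@leq_trans ((S * M) * (S' * M))).
  by rewrite -(mulnA T) mulnAC [leqRHS]mulnACA leq_mul.
apply: leq_trans (leq_mul Lm Lm') _.
by rewrite mulnA leq_mul// leq_mul.
Qed.

(** Equal terms are grouped. Counting by [index] charges each term to its first occurrence, so [W]
    may contain repetitions. *)
Lemma sum_multiplicities (W t : seq R) B :
  {subset t <= W} -> (size t <= B)%N ->
  exists c : {ffun 'I_(size W) -> 'I_B.+1},
    \sum_(x <- t) x = \sum_(i < size W) W`_i *+ c i.
Proof.
move=> tW tB.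
have cB i : (count (fun x => index x W == i) t < B.+1)%N.
  by rewrite ltnS (leq_trans (count_size _ _)).
exists [ffun i : 'I_(size W) => Ordinal (cB i)].
under [RHS]eq_bigr => i _ do rewrite ffunE /= -iter_addr_0 -big_const_seq big_mkcond.
rewrite [RHS]exchange_big /=; apply: eq_big_seq => x /tW xW.
have iW : (index x W < size W)%N by rewrite index_mem.
rewrite -big_mkcond (big_pred1 (Ordinal iW)) /= ?nth_index//.
Qed.

Lemma nilpotent_growth :
  finite_set X -> nilpotent -> polynomially_bounded X.
Proof.
move=> Xfin [n nilR].
(* The bound is raised to [n.+1] because [uses_words] needs it positive. *)
have w0 d x : word d x -> (n.+1 < d)%N -> x = 0.
  by move=> wx /ltnW; apply: word_eq0 nilR wx.
have [W WP] := finite_words n.+1 Xfin.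
exists (n.+1 * size W)%N, (2 ^ size W)%N => M M0.
(* Every weight is at least 1, so an element of [at_most X M] is a sum of at most M^{n+1} words, and
   its multiplicities determine it. *)
pose f (c : {ffun 'I_(size W) -> 'I_(M ^ n.+1).+1}) := \sum_(i < size W) W`_i *+ c i.
have sub : at_most X M `<=` range f.
  move=> a [m mM /(uses_words w0 (ltn0Sn n) M0)/(_ mM)[L [-> Lw Lm]]].
  have [||c ec] := @sum_multiplicities W [seq p.2 | p <- L] (M ^ n.+1).
  - by move=> _ /mapP[p /Lw[wp pn] ->]; apply: WP wp pn.
  - rewrite size_map -(leq_pmul2r M0); apply: (@leq_trans (m * M ^ n.+1)); last first.
      by rewrite mulnC leq_mul.
    apply: leq_trans Lm; rewrite leq_mul// -sum1_size leq_sum// => p _.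
    by rewrite expn_gt0 M0.
  by exists c => //; rewrite /f -ec big_map.
apply: card_le_trans (subset_card_le sub) _.
apply: card_le_trans (card_range_fin f) _.
rewrite card_le_II card_ffun !card_ord expnM -expnMn.
case: (posnP (size W)) => [->|W0]; first by rewrite !expn0.
by rewrite leq_exp2r// mul2n -addnn -addn1 leq_add2l expn_gt0 M0.
Qed.

End NilpotentGrowth.

(** * Symmetric generating sets and the equivalence *)

Lemma finitely_generated_symmetric : finitely_generated R ->
  exists X, [/\ finite_set X, additively_symmetric X & generates X].
Proof.
case=> X [Xfin genX]; exists (X `|` -%R @` X `|` [set 0]); split.
- rewrite !finite_setU; split; last exact: finite_set1.
  by split=> //; apply: finite_image.
- split=> [|x [[Xx|[y Xy <-]]|->]]; first by right.
  + by left; right; exists x.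
  + by left; left; rewrite opprK.
  + by right; rewrite oppr0.
- by move=> S Ssub YS; apply: genX => // x Xx; apply: YS; left; left.
Qed.

End RngTheory.

Theorem theorem1p4 (R : rngType) :
  finitely_generated R -> torsion_free R ->
  (polynomial_growth R <-> virtually_nilpotent R).
Proof.
move=> fgR tfR; split.
  move=> [X [_ Xsym genX Xpoly]]; apply: nilpotent_virtually.
  exact: growth_nilpotent tfR Xsym genX Xpoly.
move=> /(virtually_nilpotent_nilpotent tfR) nilR.
have [X [Xfin Xsym genX]] := finitely_generated_symmetric fgR.
by exists X; split=> //; apply: nilpotent_growth.
Qed.
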